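(* Let $G$ be a finite simple graph. Then $c(G)=1$ if and only if $d_{\min}(G)=1$.
   Context: Graphs are finite, without loops or multiple edges. An orientation $D$ of $G$ assigns a direction to every edge of $G$; it is acyclic if it contains no directed cycle. An arc $u\to v$ of an acyclic orientation $D$ is dependent if reversing it creates a directed cycle (equivalently, there is a directed walk of length at least $2$ from $u$ to $v$ in $D$). $d(D)$ is the number of dependent arcs of $D$, and $d_{\min}(G)$ is the minimum of $d(D)$ over all acyclic orientations $D$ of $G$. A cover graph is the underlying undirected graph of the Hasse diagram (covering relation) of a finite partially ordered set. $c(G)=\min\{|F| : F\subseteq E(G) \text{ and } G-F \text{ is a cover graph}\}$, where $G-F$ is obtained by deleting the edges in $F$ (keeping all vertices). *)

(* Defs.v *)
From HB Require Import structures.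
From mathcomp Require Import all_boot all_order.
From mathcomp Require Import boolp.

Set Implicit Arguments.
Unset Strict Implicit.
Unset Printing Implicit Defensive.

Import Order.TTheory.

Record sgraph := SGraph {
  vertex :> finType;
  adj : rel vertex;
  adj_sym : symmetric adj;
  adj_irr : irreflexive adj
}.

Section Orientations.
Variable G : sgraph.

(* A set of arcs; (u, v) is the arc u -> v. *)
Implicit Type D : {set G * G}.

Definition arc D : rel G := fun u v => (u, v) \in D.

Definition orientation D : Prop :=
  (forall u v, arc D u v -> adj u v) /\
  (forall u v, adj u v -> arc D u v (+) arc D v u).

(* The empty sequence satisfies [ucycle] and has to be excluded. *)
Definition acyclic D : Prop :=
  forall s : seq G, s != [::] -> ~ ucycle (arc D) s.

Definition acyclic_orientation D : Prop := orientation D /\ acyclic D.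

Definition reverse_arc D (a : G * G) : {set G * G} := (a.2, a.1) |: (D :\ a).

Definition dependent_arcs D : {set G * G} :=
  [set a in D | `[< ~ acyclic (reverse_arc D a) >]].

Definition dep D : nat := #|dependent_arcs D|.

Lemma acyclic_orientation_exists : exists D, acyclic_orientation D.
Proof.
pose r (x : G) : nat := enum_rank x.
pose D : {set G * G} := [set a | adj a.1 a.2 && (r a.1 < r a.2)].
have arcE u v : arc D u v = adj u v && (r u < r v) by rewrite /arc inE.
exists D; split; first split.
- by move=> u v; rewrite arcE => /andP[].
- move=> u v uv; rewrite !arcE (adj_sym v u) uv /=.
  have: r u != r v.
    apply/negP => /eqP /ord_inj /enum_rank_inj uv_eq.
    by move: uv; rewrite uv_eq adj_irr.
  by case: ltngtP.
- case=> [//|x s] _ /andP[xs _].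
  have r_path y p : path (arc D) y p -> r y <= r (last y p).
    elim: p y => [|z p IHp] y //= /andP[]; rewrite arcE => /andP[_ /ltnW yz].
    by move/IHp; apply: leq_trans.
  move: xs; rewrite /= rcons_path arcE => /and3P[/r_path h _].
  by rewrite ltnNge h.
Qed.

Definition dep_value : pred nat :=
  fun n => `[< exists2 D : {set G * G}, acyclic_orientation D & dep D = n >].

Lemma dep_value_exists : exists n, dep_value n.
Proof.
have [D HD] := acyclic_orientation_exists.
by exists (dep D); apply/asboolP; exists D.
Qed.

Definition dep_min : nat := ex_minn dep_value_exists.

End Orientations.

Definition covers (disp : Order.disp_t) (P : porderType disp) (x y : P) : Prop :=
  (x < y)%O /\ forall z : P, ~~ (x < z < y)%O.

Definition cover_graph (G : sgraph) : Prop :=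
  exists (disp : Order.disp_t) (P : finPOrderType disp) (f : G -> P),
    bijective f /\
    forall x y, adj x y <-> covers (f x) (f y) \/ covers (f y) (f x).

Section EdgeDeletion.
Variable G : sgraph.

Definition edges : {set {set G}} :=
  [set [set p.1; p.2] | p : G * G & adj p.1 p.2].

Implicit Type F : {set {set G}}.

Definition del_adj F : rel G :=
  fun x y => adj x y && ([set x; y] \notin F).

Lemma del_adj_sym F : symmetric (del_adj F).
Proof. by move=> x y; rewrite /del_adj adj_sym setUC. Qed.

Lemma del_adj_irr F : irreflexive (del_adj F).
Proof. by move=> x; rewrite /del_adj adj_irr. Qed.

Definition del_edges F : sgraph := SGraph (del_adj_sym F) (del_adj_irr F).

Lemma cover_graph_del_all : cover_graph (del_edges edges).
Proof.
pose disp := Order.Disp tt tt.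
have r_refl : reflexive (@eq_op G) by move=> x; exact: eqxx.
have r_anti : antisymmetric (@eq_op G) by move=> x y /andP[/eqP].
have r_trans : transitive (@eq_op G) by move=> y x z /eqP-> /eqP->.
pose mix := @Order.Le_isPOrder.Build disp G
  (@eq_op G) r_refl r_anti r_trans.
pose P : finPOrderType disp := HB.pack (G : Type) (vertex G) mix.
exists disp, P, id; split; first by exists id.
have ltF (x y : P) : (x < y)%O = false.
  by rewrite lt_neqAle; apply/negP => /andP[/negP].
move=> x y; split=> [/andP[xy /negP[]]|[] []]; last 2 first.
- by rewrite ltF.
- by rewrite ltF.
by apply/imsetP; exists (x, y); rewrite ?inE.
Qed.

Definition cover_del_value : pred nat :=
  fun n => `[< exists F : {set {set G}},
    [/\ F \subset edges, cover_graph (del_edges F) & #|F| = n] >].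

Lemma cover_del_value_exists : exists n, cover_del_value n.
Proof.
exists #|edges|; apply/asboolP; exists edges.
by split=> //; exact: cover_graph_del_all.
Qed.

Definition cover_del_num : nat := ex_minn cover_del_value_exists.

End EdgeDeletion.

(* Main.v *)
Require Import Defs.
From mathcomp Require Import all_boot.
From HB Require Import structures.
From mathcomp Require Import all_order.
From mathcomp Require Import boolp.
(* [arc] means the arc relation of an orientation, not [path.arc]. *)
Import Defs.

Set Implicit Arguments.
Unset Strict Implicit.
Unset Printing Implicit Defensive.

(** Deleting the dependent arcs of an acyclic orientation leaves its Hasse
    diagram, so c(G) <= d_min(G), and a cover graph has d_min = 0. It remains
    to see that c(G) = 1 forces d_min(G) <= 1. Let G - xy be a cover graph,
    oriented as a Hasse diagram. The set S of vertices reachable from x is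
    closed under arcs; reversing all arcs that enter S preserves the number of
    forward and backward arcs of every cycle, hence again gives a Hasse diagram,
    in which strictly more vertices are reachable from x. Iterating, x reaches
    every vertex of its connected component. Now add the arc x -> y: if y is in
    that component then reachability does not change and only x -> y is
    dependent, and otherwise xy is a bridge and nothing is dependent. *)

(** * Reachability and Hasse diagrams of finite digraphs *)

Section Digraphs.
Variable T : finType.
Implicit Types (e : rel T) (u v w x y : T) (S : {set T}).

Lemma eq_set2 (a b c d : T) :
  [set a; b] = [set c; d] -> (a, b) = (c, d) \/ (a, b) = (d, c).
Proof.
move=> E; have aE : a \in [set c; d] by rewrite -E set21.
have bE : b \in [set c; d] by rewrite -E set22.
have cE : c \in [set a; b] by rewrite E set21.
have dE : d \in [set a; b] by rewrite E set22.
move: aE bE cE dE => /set2P[]-> /set2P[]->; auto.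
  by move=> _ /set2P[]->; left.
by move=> /set2P[]->; left.
Qed.

Definition acyclic_rel e := forall u v, e u v -> ~~ connect e v u.

(** The condition [w != v] makes the walk from [u] to [v] have length at least 2. In an acyclic
    relation every such walk qualifies, since a first step to [v] would close a cycle. *)
Definition shortcut e : rel T :=
  fun u v => [exists w, [&& e u w, w != v & connect e w v]].

Definition hasse_rel e :=
  acyclic_rel e /\ forall u v, e u v -> ~~ shortcut e u v.

Definition add_arc e a b : rel T := fun u v => e u v || ((u, v) == (a, b)).

Definition flip_cut e S : rel T :=
  fun u v => if (u \in S) == (v \in S) then e u v else e v u.

Lemma connect_step e u v :
  connect e u v -> u = v \/ exists2 w, e u w & connect e w v.
Proof.
case/connectP=> -[|w p] /=; first by move=> _ ->; left.
by case/andP=> uw wp ->; right; exists w => //; apply/connectP; exists p.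
Qed.

Lemma connect_stable e (P : pred T) u v :
  (forall a b, e a b -> P a -> P b) -> connect e u v -> P u -> P v.
Proof.
move=> eP /connectP[p ep ->]; elim: p u ep => //= w p IHp u /andP[uw wp] Pu.
exact/IHp/(eP u).
Qed.

Lemma acyclic_connect_anti e u v :
  acyclic_rel e -> connect e u v -> connect e v u -> u = v.
Proof.
move=> acy /connect_step[//|[w uw wv]] vu.
by have := acy u w uw; rewrite (connect_trans wv vu).
Qed.

Lemma shortcutI e u v w : e u w -> w != v -> connect e w v -> shortcut e u v.
Proof. by move=> uw wv cwv; apply/existsP; exists w; rewrite uw wv. Qed.

Lemma hasse_shortcut e u v w :
  hasse_rel e -> e u v -> e u w -> connect e w v -> w = v.
Proof.
move=> [_ nsc] uv uw wv; apply/eqP; apply: contraNT (nsc u v uv) => wNv.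
exact: shortcutI wv.
Qed.

(** In a Hasse diagram the arc [u -> v] is the only walk from [u] to [v]. A walk starting with
    another arc before [a -> b] must step to [v] at once, and returning to [v] through [a -> b]
    closes a cycle. *)
Lemma hasse_arc_unique e u v a b :
  hasse_rel e -> e u v -> connect e u a -> e a b -> connect e b v ->
  u = a /\ b = v.
Proof.
move=> he uv /connect_step[<-|[w uw wa]] ab bv.
  by split=> //; apply: hasse_shortcut he uv ab bv.
have av := connect_trans (connect1 ab) bv.
have wE := hasse_shortcut he uv uw (connect_trans wa av).
by have := he.1 a b ab; rewrite (connect_trans bv) // -wE.
Qed.

(** A walk using the new arc is cut before its first and after its last use. *)
Lemma connect_add_arc e a b u v :
  connect (add_arc e a b) u v ->
  connect e u v || (connect e u a && connect e b v).
Proof.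
case/connectP=> p ep ->; elim: p u ep => [|w p IHp] u /=.
  by rewrite connect0.
case/andP=> /orP[uw|/eqP[-> ->]] /IHp.
  case/orP=> [wv|/andP[wa bv]]; apply/orP; [left|right].
    exact: connect_trans (connect1 uw) wv.
  by rewrite bv (connect_trans (connect1 uw) wa).
by rewrite connect0 => /orP[->|/andP[_ ->]]; rewrite orbT.
Qed.

Lemma acyclic_add_arc e a b :
  acyclic_rel e -> ~~ connect e b a -> acyclic_rel (add_arc e a b).
Proof.
move=> acy nba u v uv; apply/negP => /connect_add_arc.
case/orP: uv => [uv|/eqP[-> ->]].
  rewrite (negPf (acy u v uv)) /= => /andP[va bu]; case/negP: nba.
  exact: connect_trans bu (connect_trans (connect1 uv) va).
by rewrite (negPf nba).
Qed.

(** As no arc of [e] leaves [S], every crossing arc points out of [S] after the flip. So a walk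
    crosses at most once, by the reversal of some [d -> c], and its remaining arcs are arcs of
    [e]. *)
Lemma connect_flip_cut e S u v :
  (forall a b, e a b -> a \in S -> b \in S) ->
  connect (flip_cut e S) u v ->
  if (u \in S) == (v \in S) then connect e u v : Prop
  else u \in S /\ exists c d,
    [/\ d \notin S, e d c, connect e u c & connect e d v].
Proof.
move=> eS /connectP[p ep ->]; elim: p u ep => [|w p IHp] u /=.
  by rewrite eqxx connect0.
case/andP=> uw /IHp{IHp}; move: (last w p) => z; move: uw; rewrite /flip_cut.
case uS: (u \in S); case wS: (w \in S); case zS: (z \in S) => //= uw.
- exact: (connect_trans (connect1 uw)).
- case=> _ [c [d [dS dc wc dz]]]; split=> //; exists c, d; split=> //.
  exact: (connect_trans (connect1 uw) wc).
- by case.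
- by move=> wz; split=> //; exists u, w; rewrite wS.
- by move: (eS _ _ uw wS); rewrite uS.
- by move: (eS _ _ uw wS); rewrite uS.
- by case.
- exact: (connect_trans (connect1 uw)).
Qed.

Lemma hasse_flip_cut e S :
  (forall a b, e a b -> a \in S -> b \in S) ->
  hasse_rel e -> hasse_rel (flip_cut e S).
Proof.
move=> eS he; split=> u v uv.
  apply/negP => /(connect_flip_cut eS); move: uv; rewrite /flip_cut.
  case uS: (u \in S); case vS: (v \in S) => //= uv.
  - by apply/negP/he.1.
  - by case.
  - by move: (eS _ _ uv vS); rewrite uS.
  - by apply/negP/he.1.
apply/existsP => -[w /and3P[uw /eqP wNv /(connect_flip_cut eS)]].
move: uv uw; rewrite /flip_cut.
case uS: (u \in S); case vS: (v \in S); case wS: (w \in S) => //= uv uw.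
- by move/(hasse_shortcut he uv uw).
- by case.
(* In [e] there is a walk from [d] through [v -> u -> w] to [c] alongside the arc [d -> c].
   Uniqueness forces [u = c], and then [u -> w] lies on a cycle. *)
- case=> _ [c [d [dS dc wc dv]]].
  have uc := connect_trans (connect1 uw) wc.
  have [_ uE] := hasse_arc_unique he dc dv uv uc.
  by have := he.1 u w uw; rewrite uE wc.
(* In [e] the arc [w -> u] runs alongside the walk from [w] to [v] followed by [v -> u], so
   [w = v]. *)
- by move=> wv; have [] := hasse_arc_unique he uw wv uv (connect0 _ _).
- by move: (eS _ _ uv vS); rewrite uS.
- by move: (eS _ _ uv vS); rewrite uS.
- by move: (eS _ _ uw wS); rewrite uS.
- by move/(hasse_shortcut he uv uw).
Qed.

(** Induction on the number of vertices that [x] does not reach. The last conclusion makes the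
    reachable set of [x] a union of connected components, hence the component of [x]. *)
Lemma hasse_reorient e x :
  hasse_rel e ->
  exists e', [/\ hasse_rel e',
    forall u v, e' u v || e' v u = e u v || e v u &
    forall u v, e' u v -> connect e' x u = connect e' x v].
Proof.
have [n] := ubnP #|[set y | ~~ connect e x y]|.
elim: n e => // n IHn e /ltnSE le_n he.
have [/existsP[d /existsP[c /and3P[dc xc xNd]]]|/existsPn closed] :=
    boolP [exists d, exists c, [&& e d c, connect e x c & ~~ connect e x d]].
  pose S := [set y | connect e x y].
  have eS a b : e a b -> a \in S -> b \in S.
    by rewrite !inE => ab xa; apply: connect_trans xa (connect1 ab).
  (* Walks from [x] stay inside [S], so the flip leaves them intact. *)
  have xS y : connect e x y -> connect (flip_cut e S) x y.
    case/connectP=> p ep ->.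
    have: x \in S by rewrite inE connect0.
    elim: p {1 2 3 4}x ep => [|w p IHp] z /=; first by rewrite connect0.
    case/andP=> zw wp zS; have wS := eS _ _ zw zS.
    apply: connect_trans (IHp w wp wS); apply: connect1.
    by rewrite /flip_cut zS wS eqxx.
  (* The reversed arc [c -> d] makes [d] newly reachable, which lowers the measure. *)
  have xd : connect (flip_cut e S) x d.
    apply: connect_trans (xS c xc) (connect1 _).
    by rewrite /flip_cut !inE xc (negPf xNd).
  have [||e' [he' symE xE]] := IHn (flip_cut e S); last first.
  - exists e'; split=> // u v; rewrite symE /flip_cut [in X in _ || X]eq_sym.
    by case: ifP => // _; rewrite orbC.
  - exact: hasse_flip_cut.
  - apply: leq_trans le_n; apply: proper_card; apply/properP; split.
      by apply/subsetP => y; rewrite !inE; apply: contra; apply: xS.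
    by exists d; rewrite !inE // xd.
exists e; split=> // u v uv; apply/idP/idP => [xu|xv].
  exact: connect_trans xu (connect1 uv).
by have /existsPn/(_ v) := closed u; rewrite uv xv /= negbK.
Qed.

End Digraphs.

(** * Acyclic orientations, dependent arcs and cover graphs *)

Section Orientations.
Variable G : sgraph.
Implicit Type D : {set G * G}.

Lemma acyclicP D : acyclic D <-> acyclic_rel (arc D).
Proof.
split=> acy.
  move=> u v uv; apply/negP => /connectP[p ep uE].
  case/shortenP: ep uE => q eq uq _ uE.
  by apply: (acy (v :: q)) => //; rewrite /ucycle /= rcons_path eq -uE uv.
case=> [//|x s] _ /andP[xs _].
move: xs; rewrite /= rcons_path => /andP[xs sx].
by case/negP: (acy _ _ sx); apply/connectP; exists s.
Qed.

Lemma dependent_arcsE D u v : acyclic_rel (arc D) ->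
  ((u, v) \in dependent_arcs D) = arc D u v && shortcut (arc D) u v.
Proof.
move=> acy; rewrite inE -/(arc D u v); have [uv|//] := boolP (arc D u v).
rewrite /=; apply/asboolP/idP => [|/existsP[w /and3P[uw wNv wv]]].
  rewrite acyclicP; apply: contra_notT => nsc.
  (* Reversing [u -> v] amounts to adding [v -> u] to [e], which is acyclic unless [e] still leads
     from [u] to [v]. *)
  pose e : rel G := fun a b => arc D a b && ((a, b) != (u, v)).
  have eD : subrel (connect e) (connect (arc D)).
    by apply: connect_sub => a b /andP[ab _]; apply: connect1.
  have acy_e : acyclic_rel e.
    by move=> a b /andP[ab _]; apply: contra (acy a b ab) => /eD.
  have revE : arc (reverse_arc D (u, v)) =2 add_arc e v u.
    by move=> a b; rewrite /arc /add_arc !inE orbC andbC.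
  move=> a b; rewrite revE (eq_connect revE).
  apply: acyclic_add_arc => //; apply: contra nsc => /connect_step[uE|].
    by have := acy u v uv; rewrite uE connect0.
  case=> w /andP[uw]; rewrite xpair_eqE eqxx /= => wNv /eD wv.
  exact: shortcutI wv.
rewrite acyclicP => /(_ v u); rewrite {1}/arc !inE eqxx => /(_ isT)/negP; apply.
apply: (@connect_trans _ _ w).
  apply: connect1.
  by rewrite /arc !inE !xpair_eqE eqxx wNv -/(arc D u w) uw orbT.
case/connectP: wv => p wp vE; apply/connectP; exists p => //.
(* No vertex on the walk from [w] to [v] reaches [u], so the walk avoids the arc [u -> v] and
   survives its reversal. *)
have nwu : ~~ connect (arc D) w u := acy _ _ uw.
elim: p w wp nwu {uw wNv vE} => //= z p IHp w /andP[wz zp] nwu.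
apply/andP; split; last first.
  by apply: IHp => //; apply: contra nwu; apply: connect_trans (connect1 wz).
rewrite /arc !inE !xpair_eqE -/(arc D w z) wz andbT; case: (w =P u) => [wu|_].
  by move: nwu; rewrite wu connect0.
by rewrite orbT.
Qed.

Lemma cover_graph_del_dependent D : acyclic_orientation D ->
  cover_graph (del_edges [set [set a.1; a.2] | a in dependent_arcs D]).
Proof.
move=> [[arcG orD] /acyclicP acy].
pose disp := Order.Disp tt tt.
have r_anti : antisymmetric (connect (arc D)).
  by move=> x y /andP[]; apply: acyclic_connect_anti.
(* The vertices are ordered by reachability in [D]; the covering pairs will be exactly the arcs that
   are not dependent. *)
pose mix := @Order.Le_isPOrder.Build disp G
  (connect (arc D)) (@connect0 _ _) r_anti (@connect_trans _ _).
pose P : finPOrderType disp := HB.pack (G : Type) (vertex G) mix.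
exists disp, P, id; split; first by exists id.
have ltP (x y : P) : (x < y)%O = (y != x) && connect (arc D) x y.
  by rewrite Order.POrderTheory.lt_def.
have covP (x y : P) :
    covers x y <-> arc D x y && ((x, y) \notin dependent_arcs D).
  split=> [[]|/andP[xy]].
    rewrite ltP => /andP[yNx /connect_step[xy|[w xw wy]]] nz.
      by rewrite xy eqxx in yNx.
    have ltxz z : arc D x z -> (x < z :> P)%O.
      move=> xz; rewrite ltP connect1 // andbT; apply/eqP => zx.
      by have := acy _ _ xz; rewrite zx connect0.
    have wE : w = y.
      apply/eqP/negP => /negP wNy; have /negP := nz w; apply.
      by rewrite ltxz // ltP eq_sym wNy.
    rewrite wE in xw; rewrite xw dependent_arcsE // xw /=.
    apply/existsP => -[z /and3P[xz zNy zy]]; have /negP := nz z; apply.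
    by rewrite ltxz // ltP eq_sym zNy.
  rewrite dependent_arcsE // xy /= => nsc; split.
    rewrite ltP connect1 // andbT; apply/eqP => yx.
    by have := acy _ _ xy; rewrite yx connect0.
  move=> z; rewrite !ltP; apply/negP => /andP[/andP[zNx xz] /andP[yNz zy]].
  case/connect_step: xz => [xz|[w xw wz]]; first by rewrite xz eqxx in zNx.
  case/negP: nsc; apply/existsP; exists w.
  rewrite xw (connect_trans wz zy) andbT.
  apply/eqP => wy; rewrite wy in wz; case/eqP: yNz.
  exact: acyclic_connect_anti acy wz zy.
pose F := [set [set a.1; a.2] | a in dependent_arcs D].
(* An unordered pair could also come from the arc [v -> u], which acyclicity excludes. *)
have delE u v : arc D u v ->
    ([set u; v] \in F) = ((u, v) \in dependent_arcs D).
  move=> uv; apply/imsetP/idP => [[[a b] ab] /=|uvd]; last by exists (u, v).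
  case/eq_set2 => -[uE vE]; first by rewrite uE vE.
  move: ab; rewrite dependent_arcsE // -uE -vE => /andP[vu _].
  by have := acy _ _ uv; rewrite connect1.
move=> u v; split=> [/andP[uv nF]|].
  case uvD: (arc D u v); [left|right]; apply/covP.
    by rewrite uvD -delE.
  have vuD : arc D v u by move: (orD u v uv); rewrite uvD.
  by rewrite vuD -delE // setUC.
have adjD a b : covers (a : P) b -> @adj (del_edges F) a b.
  by move/covP=> /andP[ab nd]; apply/andP; rewrite arcG // delE.
by case=> /adjD // vu; rewrite adj_sym.
Qed.

Lemma cover_del_num_le_dep_min : cover_del_num G <= dep_min G.
Proof.
rewrite /dep_min; case: ex_minnP => n /asboolP[D aoD <-] _.
pose F := [set [set a.1; a.2] | a in dependent_arcs D].
rewrite /cover_del_num; case: ex_minnP => m _ /(_ #|F|) le_m.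
apply: leq_trans (leq_imset_card _ _); apply: le_m; apply/asboolP; exists F.
split=> //; last exact: cover_graph_del_dependent.
apply/subsetP => _ /imsetP[[u v] uvD ->]; apply/imsetP; exists (u, v) => //.
by move: uvD; rewrite !inE => /andP[uvD _]; apply: aoD.1.1.
Qed.

(** Each edge is oriented upwards in the order. Injectivity of [f] turns an intermediate vertex of a
    shortcut into a point strictly between the two ends of a cover. *)
Lemma cover_graph_hasse (H : sgraph) : cover_graph H ->
  exists2 e : rel H, hasse_rel e & forall u v, adj u v = e u v || e v u.
Proof.
move=> [disp [P [f [/bij_inj f_inj adjP]]]].
pose e : rel H := fun u v => adj u v && (f u < f v)%O.
have e_cov u v : e u v -> covers (f u) (f v).
  case/andP=> /adjP[//|[vu _] uv].
  by have := Order.POrderTheory.lt_trans uv vu; rewrite Order.POrderTheory.ltxx.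
have le_f u v : connect e u v -> (f u <= f v)%O.
  move=> uv; apply: (connect_stable (P := fun w => (f u <= f w)%O) _ uv) => //.
  move=> a b /andP[_ /Order.POrderTheory.ltW ab] ua.
  exact: Order.POrderTheory.le_trans ua ab.
exists e; first split.
- move=> u v /andP[_ uv]; apply/negP => /le_f vu.
  have := Order.POrderTheory.lt_le_trans uv vu.
  by rewrite Order.POrderTheory.ltxx.
- move=> u v /e_cov[_ nz]; apply/existsP => -[w /and3P[/andP[_ uw] wNv wv]].
  have /negP := nz (f w); apply; rewrite uw Order.POrderTheory.lt_neqAle.
  by rewrite le_f // andbT; apply: contra wNv => /eqP/f_inj->.
- move=> u v; rewrite /e (adj_sym v u) -andb_orr.
  apply/idP/andP => [uv|[]//]; split=> //.
  by case/adjP: uv => -[-> _]; rewrite ?orbT.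
Qed.

(** This passes from relations to orientations as arc sets; it is applied with [X] empty and with
    [X] a single arc. *)
Lemma dep_min_le (e : rel G) (X : {set G * G}) :
  acyclic_rel e -> (forall u v, adj u v = e u v || e v u) ->
  (forall u v, e u v -> shortcut e u v -> (u, v) \in X) -> dep_min G <= #|X|.
Proof.
move=> acy adjE scX; pose D : {set G * G} := [set a | e a.1 a.2].
have arcE : arc D =2 e by move=> u v; rewrite /arc inE.
have acyD : acyclic_rel (arc D).
  by move=> u v; rewrite arcE (eq_connect arcE); apply: acy.
rewrite /dep_min; case: ex_minnP => n _ /(_ (dep D)) le_n.
apply: (@leq_trans (dep D)); last first.
  apply/subset_leq_card/subsetP => -[u v]; rewrite dependent_arcsE // arcE.
  case/andP=> uv /existsP[w]; rewrite arcE (eq_connect arcE) => uvw.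
  by apply: scX => //; apply/existsP; exists w.
apply: le_n; apply/asboolP; exists D => //; split; last exact/acyclicP.
split=> u v; first by rewrite arcE adjE => ->.
rewrite !arcE adjE; case uv: (e u v); case vu: (e v u) => //=.
by have := acy u v uv; rewrite connect1.
Qed.

Lemma cover_del_num0_dep_min : cover_del_num G = 0 -> dep_min G = 0.
Proof.
rewrite /cover_del_num; case: ex_minnP => n /asboolP[F [_ covF cF]] _ n0.
have F0 : F = set0 by apply/cards0_eq; rewrite cF.
have [e [acy nsc] adjE] := cover_graph_hasse covF.
apply/eqP; rewrite -leqn0 -(cards0 (G * G)%type); apply: (@dep_min_le e) => //.
  by move=> u v; rewrite -adjE /= /del_adj F0 inE andbT.
by move=> u v /nsc/negPf->.
Qed.

Lemma cover_del_num1_dep_min_le : cover_del_num G = 1 -> dep_min G <= 1.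
Proof.
rewrite /cover_del_num; case: ex_minnP => n /asboolP[F [sF covF cF]] _ n1.
have /cards1P[E FE] : #|F| == 1 by rewrite cF n1.
have /imsetP[[x y]] : E \in edges G by apply: (subsetP sF); rewrite FE inE.
rewrite inE /= => xy EE; subst E; subst F.
have [e0 he0 adjE0] := cover_graph_hasse covF.
have [e [he symE xE]] := hasse_reorient x he0.
have {he0 adjE0 symE} adjE u v :
    adj u v && ([set u; v] != [set x; y]) = e u v || e v u.
  by rewrite symE -adjE0 /= /del_adj inE.
have [acy nsc] := he.
have xconn a b : connect e a b -> connect e x a = connect e x b.
  move=> ab; apply/esym/eqP.
  pose P w := connect e x w == connect e x a.
  apply: (connect_stable (P := P) _ ab); last exact: eqxx.
  by rewrite /P; move=> c d /xE->.
(* If [y] reached [x], both would lie in the reachable set of [x], giving walks in both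
   directions. *)
have nyx : ~~ connect e y x.
  have [cxy|ncxy] := boolP (connect e x y).
    apply/negP => /(acyclic_connect_anti acy cxy) xyE.
    by move: xy; rewrite xyE adj_irr.
  by apply: contra ncxy => /xconn->; exact: connect0.
rewrite -(cards1 (x, y)); apply: (@dep_min_le (add_arc e x y)).
- exact: acyclic_add_arc.
- move=> u v; rewrite /add_arc orbACA -adjE.
  have [/eq_set2 uvE|uvN] := eqVneq; last first.
    rewrite andbT; case: eqP => [[uE vE]|_]; first by rewrite uE vE eqxx in uvN.
    case: eqP => [[vE uE]|_]; last by rewrite !orbF.
    by rewrite uE vE setUC eqxx in uvN.
  case: uvE => -[-> ->]; first by rewrite xy eqxx orbT.
  by rewrite adj_sym xy eqxx !orbT.
move=> u v uv; rewrite inE; case/orP: uv => [uv|//].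
(* No arc of [e] gains a shortcut: the cases record whether the first arc, or the rest of the walk,
   uses [x -> y]. *)
case/existsP=> w /and3P[uw wNv /connect_add_arc wv]; exfalso.
case/orP: uw => [uw|/eqP[uE wE]]; case/orP: wv => [wv|/andP[wx yv]].
- by case/eqP: wNv; apply: hasse_shortcut he uv uw wv.
- have cxy : connect e x y.
    by rewrite (xconn _ _ yv) -(xE _ _ uv) (xE _ _ uw) (xconn _ _ wx) connect0.
  case/eqP: wNv; apply: hasse_shortcut he uv uw _.
  exact: connect_trans wx (connect_trans cxy yv).
(* Now [y] reaches [v], so [x] reaches [y] in [e]. As [x -> v] is an arc, that walk must start with
   it, so [v] and [y] reach each other. *)
- subst u w.
  have: connect e x y by rewrite (xconn _ _ wv) connect1.
  case/connect_step=> [xyE|[z xz zy]]; first by rewrite xyE adj_irr in xy.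
  have zv := hasse_shortcut he uv xz (connect_trans zy wv).
  by case/eqP: wNv; apply: acyclic_connect_anti wv _; rewrite -?zv.
- by case/negP: nyx; rewrite -wE.
Qed.

End Orientations.

Theorem theorem3 (G : sgraph) : cover_del_num G = 1 <-> dep_min G = 1.
Proof.
split=> [c1|d1].
  apply/eqP; rewrite eqn_leq cover_del_num1_dep_min_le // lt0n; apply/eqP => d0.
  by have := cover_del_num_le_dep_min G; rewrite c1 d0.
apply/eqP; rewrite eqn_leq -{1}d1 cover_del_num_le_dep_min lt0n /=.
by apply/eqP => /cover_del_num0_dep_min; rewrite d1.
Qed.
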